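(* Let $\mathcal A$ be a unital complex $*$-algebra and let $(\Omega^1_{\mathrm d}(\mathcal A),\dagger,\Psi,\langle\cdot|\cdot\rangle,\sigma^{\mathrm{can}})$ be a centred Hermitian differential calculus over $\mathcal A$. Then $D_{\mathbb C}$ is a complex Lie algebra of derivations, i.e. $D_{\mathbb C}$ is stable under the commutator of derivations. Hence $D$ is a real Lie subalgebra of the set $\mathrm{Der}(\mathcal A)^\dagger$ of Hermitian derivations.
   Context: A $\dagger$-bimodule over a unital complex $*$-algebra $\mathcal A$ is an $\mathcal A$-bimodule with an antilinear involution $\dagger$ satisfying $(axb)^\dagger=b^*x^\dagger a^*$. A Hermitian first-order differential structure over $\mathcal A$ consists of a $\dagger$-bimodule $\Omega=\Omega^1_{\mathrm d}(\mathcal A)$, a $\mathbb C$-linear derivation $\mathrm d:\mathcal A\to\Omega$ with $\mathrm d(a^* )=-\mathrm d(a)^\dagger$, such that every element of $\Omega$ is a finite sum $\sum a_i\,\mathrm d b_i$, $\Omega$ is finitely generated projective as an $\mathcal A$-module, together with a biadditive map $\langle\cdot|\cdot\rangle:\Omega\times\Omega\to\mathcal A$ with: (1) $\langle\omega|\eta a\rangle=\langle\omega|\eta\rangle a$; (2) $\langle\omega|\eta\rangle^*=\langle\eta|\omega\rangle$; (3) $\langle a\omega|\eta\rangle=\langle\omega|a^*\eta\rangle$; (4) $\omega\mapsto(\eta\mapsto\langle\omega^\dagger|\eta\rangle)$ is an isomorphism of left $\mathcal A$-modules from $\Omega$ onto the right-$\mathcal A$-linear maps $\Omega\to\mathcal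 A$. $T^2_{\mathrm d}(\mathcal A)=\Omega\otimes_{\mathcal A}\Omega$ with $(\omega\otimes\eta)^\dagger=\eta^\dagger\otimes\omega^\dagger$. The centre of a bimodule is $\mathcal Z(\mathcal Y)=\{y:ay=ya\ \forall a\in\mathcal A\}$; $\mathcal Y$ is centred if generated as a bimodule by $\mathcal Z(\mathcal Y)$. If $\Omega$ is centred there is a unique invertible bimodule map $\sigma^{\mathrm{can}}$ on $T^2_{\mathrm d}(\mathcal A)$ with $(\sigma^{\mathrm{can}})^{-1}\circ\dagger=\dagger\circ\sigma^{\mathrm{can}}$ and $\sigma^{\mathrm{can}}(\omega\otimes\eta)=\eta\otimes\omega$ whenever $\omega$ or $\eta$ is central; it is an involution. Put $\Psi=\frac12(1+\sigma^{\mathrm{can}})$, $g(\omega\otimes\eta)=-\langle\omega^\dagger|\eta\rangle$, and $JT^2_{\mathrm d}=\{\sum\mathrm d a_i\otimes\mathrm d b_i:\sum a_i\,\mathrm d b_i=0\}$ (finite sums). A centred Hermitian differential calculus is a Hermitian first-order differential structure such that $\Omega$ is centred, $g\circ\sigma^{\mathrm{can}}=g$ and $JT^2_{\mathrm d}\subset\operatorname{Im}\Psi$. $\mathrm{Der}(\mathcal A)$ is the complex Lie algebra of $\mathbb C$-linear derivations $\mathcal A\to\mathcal A$. A derivation $\partial$ is Hermitian if $\partial(a^* )^*=\partial(a)$ for all $a$; $\mathrm{Der}(\mathcal A)^\dagger$ is the set of these. $$D_{\mathbb C}=\Big\{\partial\in\mathrm{Der}(\mathcal A):\ \forall a_i,b_i\in\mathcal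 A,\ \sum_i a_i\,\mathrm d b_i=0\implies\sum_i a_i\,\partial b_i=0\Big\},\qquad D=D_{\mathbb C}\cap\mathrm{Der}(\mathcal A)^\dagger .$$ *)

(* Defs.v *)
From HB Require Import structures.
From mathcomp Require Import all_boot all_order all_algebra.
From mathcomp Require Import generic_quotient complex.
From mathcomp Require Import boolp classical_sets functions reals.

Set Implicit Arguments.
Unset Strict Implicit.
Unset Printing Implicit Defensive.

Import Order.TTheory GRing.Theory Num.Theory.

Local Open Scope classical_set_scope.
Local Open Scope ring_scope.

HB.mixin Record Algebra_isStarAlgebra (C : numClosedFieldType) A
    of GRing.Algebra C A := {
  star : A -> A;
  starD : forall a b, star (a + b) = star a + star b;
  starZ : forall (k : C) a, star (k *: a) = k^* *: star a;
  starM : forall a b, star (a * b) = star b * star a;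
  starK : involutive star }.

#[short(type="starAlgType")]
HB.structure Definition StarAlgebra (C : numClosedFieldType) :=
  {A of GRing.Algebra C A & Algebra_isStarAlgebra C A}.

(* The complex vector space structure of a bimodule over the complex algebra A
   is the one induced by C -> A, k |-> k%:A; [ractA] says that the left and the
   right actions of A induce the same one. *)
HB.mixin Record Lmodule_isBimodule (C : numClosedFieldType)
    (A : starAlgType C) V of GRing.Lmodule A V := {
  ract : V -> A -> V;
  ractDl : forall a, {morph ract^~ a : x y / x + y};
  ractDr : forall x a b, ract x (a + b) = ract x a + ract x b;
  ract1 : forall x, ract x 1 = x;
  ractM : forall x a b, ract x (a * b) = ract (ract x a) b;
  scaler_ract : forall a x b, a *: ract x b = ract (a *: x) b;
  ractA : forall x (k : C), ract x k%:A = k%:A *: x }.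

#[short(type="bimodType")]
HB.structure Definition Bimodule (C : numClosedFieldType)
    (A : starAlgType C) :=
  {V of GRing.Lmodule A V & Lmodule_isBimodule C A V}.

HB.mixin Record Bimodule_isDagger (C : numClosedFieldType)
    (A : starAlgType C) V of Bimodule C A V := {
  dag : V -> V;
  dagD : {morph dag : x y / x + y};
  dagZ : forall (k : C) x, dag (k%:A *: x) = (k^*)%:A *: dag x;
  dagK : involutive dag;
  dag_bimod : forall a x b,
    dag (ract (a *: x) b) = ract (star b *: dag x) (star a) }.

#[short(type="daggerBimodType")]
HB.structure Definition DaggerBimodule (C : numClosedFieldType)
    (A : starAlgType C) :=
  {V of Bimodule C A V & Bimodule_isDagger C A V}.

Arguments bimodType {C} A.
Arguments daggerBimodType {C} A.

Section BimoduleNotions.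
Context {C : numClosedFieldType} {A : starAlgType C}.
Implicit Types V W : bimodType A.

Definition centre V : set V := [set y | forall a : A, a *: y = ract y a].

Definition sub_bimodule V : set (set V) := [set P |
  [/\ P 0, (forall x y, P x -> P y -> P (x + y)),
      (forall (a : A) x, P x -> P (a *: x))
    & (forall x (a : A), P x -> P (ract x a))]].

Definition centred V : Prop :=
  smallest (sub_bimodule (V := V)) (centre (V := V)) = setT.

Definition bimodule_map V W (f : V -> W) : Prop :=
  [/\ {morph f : x y / x + y}, (forall (a : A) x, f (a *: x) = a *: f x)
    & (forall x (a : A), f (ract x a) = ract (f x) a)].

Definition right_linear V (f : V -> A) : Prop :=
  {morph f : x y / x + y} /\ (forall x (a : A), f (ract x a) = f x * a).

(* A finitely generated projective left module is a direct summand of a free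
   module of finite rank. *)
Definition fg_projective (V : lmodType A) : Prop :=
  exists n (i : {linear V -> 'rV[A]_n}) (p : {linear 'rV[A]_n -> V}),
    cancel i p.

Lemma ract0 V (x : V) : ract x 0 = 0.
Proof. by apply: (addrI (ract x 0)); rewrite -ractDr !addr0. Qed.

Lemma ract0l V (a : A) : ract (0 : V) a = 0.
Proof. by apply: (addrI (ract 0 a)); rewrite -ractDl !addr0. Qed.

Lemma ractNl V (x : V) (a : A) : ract (- x) a = - ract x a.
Proof. by apply: (addrI (ract x a)); rewrite -ractDl !subrr ract0l. Qed.

Lemma dag0 (V : daggerBimodType A) : dag (0 : V) = 0.
Proof. by apply: (addrI (dag 0)); rewrite -dagD !addr0. Qed.

Lemma dag_scale (V : daggerBimodType A) (a : A) (x : V) :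
  dag (a *: x) = ract (dag x) (star a).
Proof.
have s1 : star (1 : A) = 1.
  by rewrite -[LHS]mul1r -{1}(starK (1 : A)) -starM mul1r starK.
by rewrite -[a *: x]ract1 dag_bimod s1 scale1r.
Qed.

Lemma dag_ract (V : daggerBimodType A) (x : V) (a : A) :
  dag (ract x a) = star a *: dag x.
Proof. by rewrite -[in LHS](dagK x) -[RHS]dagK dag_scale starK. Qed.

End BimoduleNotions.

Section Tensor.
Context {C : numClosedFieldType} {A : starAlgType C}.
Variables M N : bimodType A.

(* A finite sequence of pairs stands for the sum of the corresponding pure
   tensors; negative terms are not needed, as - (x (x) y) = (- x) (x) y. *)
Inductive tens_eq : seq (M * N) -> seq (M * N) -> Prop :=
| tens_refl s : tens_eq s s
| tens_sym s t : tens_eq s t -> tens_eq t s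
| tens_trans s t u : tens_eq s t -> tens_eq t u -> tens_eq s u
| tens_cat s s' t t' :
    tens_eq s s' -> tens_eq t t' -> tens_eq (s ++ t) (s' ++ t')
| tens_catC s t : tens_eq (s ++ t) (t ++ s)
| tens_zero y : tens_eq [:: (0, y)] [::]
| tens_addl x x' y : tens_eq [:: (x + x', y)] [:: (x, y); (x', y)]
| tens_addr x y y' : tens_eq [:: (x, y + y')] [:: (x, y); (x, y')]
| tens_bal x (a : A) y : tens_eq [:: (ract x a, y)] [:: (x, a *: y)].

Definition tens_rel : rel (seq (M * N)) := fun s t => `[< tens_eq s t >].

Lemma tens_rel_equiv : equiv_class_of tens_rel.
Proof.
split=> [s|s t|t s u]; first exact/asboolP/tens_refl.
  by apply/asboolP/asboolP; exact: tens_sym.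
by move=> /asboolP st /asboolP tu; exact/asboolP/(tens_trans st tu).
Qed.

Canonical tens_equiv := EquivRelPack tens_rel_equiv.

Definition tensor := {eq_quot tens_equiv}%qT.
HB.instance Definition _ := Choice.on tensor.

Definition tens_of (s : seq (M * N)) : tensor := (\pi s)%qT.

Lemma tens_ofP s t : tens_of s = tens_of t <-> tens_eq s t.
Proof.
split; first by move=> /eqmodP /asboolP.
by move=> st; apply/eqmodP/asboolP.
Qed.

Lemma tens_of_repr t : tens_of (repr t) = t.
Proof. exact: reprK. Qed.

Lemma tens_eq_repr s : tens_eq (repr (tens_of s)) s.
Proof. by apply/tens_ofP; rewrite tens_of_repr. Qed.

Lemma tens_ind (P : tensor -> Prop) : (forall s, P (tens_of s)) -> forall t, P t.
Proof. by move=> Ps t; rewrite -(tens_of_repr t). Qed.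

Definition tadd (t u : tensor) : tensor := tens_of (repr t ++ repr u).
Definition topp (t : tensor) : tensor :=
  tens_of [seq (- p.1, p.2) | p <- repr t].

Lemma taddE s t : tadd (tens_of s) (tens_of t) = tens_of (s ++ t).
Proof. by apply/tens_ofP; apply: tens_cat; apply: tens_eq_repr. Qed.

Lemma taddA : associative tadd.
Proof.
by elim/tens_ind=> s; elim/tens_ind=> t; elim/tens_ind=> u; rewrite !taddE catA.
Qed.

Lemma taddC : commutative tadd.
Proof.
by elim/tens_ind=> s; elim/tens_ind=> t; rewrite !taddE; apply/tens_ofP/tens_catC.
Qed.

Lemma tadd0 : left_id (tens_of [::]) tadd.
Proof. by elim/tens_ind=> s; rewrite taddE. Qed.

Lemma tens_eq_opp (s : seq (M * N)) :
  tens_eq ([seq (- p.1, p.2) | p <- s] ++ s) [::].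
Proof.
elim: s => [|[x y] s IHs]; first exact: tens_refl.
rewrite map_cons cat_cons -cat1s -[(x, y) :: s]cat1s.
have h : tens_eq ([:: (- x, y)] ++ [:: (x, y)]) [::].
  apply: tens_trans (tens_zero y); rewrite -(addNr x).
  exact/tens_sym/tens_addl.
apply: (@tens_trans _ ([:: (- x, y)] ++ ([:: (x, y)] ++
   ([seq (- p.1, p.2) | p <- s] ++ s)))).
  apply: tens_cat; first exact: tens_refl.
  rewrite !catA; apply: tens_cat; last exact: tens_refl.
  exact: tens_catC.
rewrite catA; exact: (tens_cat h IHs).
Qed.

Lemma taddN : left_inverse (tens_of [::]) topp tadd.
Proof.
move=> t; rewrite -{2}(tens_of_repr t) /topp taddE.
exact/tens_ofP/tens_eq_opp.
Qed.

HB.instance Definition _ := GRing.isZmodule.Build tensor taddA taddC tadd0 taddN.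

Definition tens (x : M) (y : N) : tensor := tens_of [:: (x, y)].

Lemma tens_ofE s : tens_of s = \sum_(p <- s) tens p.1 p.2.
Proof.
elim: s => [|[x y] s IHs]; first by rewrite big_nil.
by rewrite big_cons -IHs -cat1s -taddE.
Qed.

Lemma tens_sumE t : t = \sum_(p <- repr t) tens p.1 p.2.
Proof. by rewrite -tens_ofE tens_of_repr. Qed.

Definition balanced (V : zmodType) (f : M -> N -> V) : Prop :=
  [/\ (forall x x' y, f (x + x') y = f x y + f x' y),
      (forall x y y', f x (y + y') = f x y + f x y')
    & (forall x (a : A) y, f (ract x a) y = f x (a *: y))].

Lemma tens_balanced : balanced tens.
Proof.
split=> [x x' y|x y y'|x a y].
- by rewrite -[RHS]/(tadd _ _) taddE; apply/tens_ofP/tens_addl.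
- by rewrite -[RHS]/(tadd _ _) taddE; apply/tens_ofP/tens_addr.
- exact/tens_ofP/tens_bal.
Qed.

(* Meaningful for balanced [f]: see [tens_liftE] and [tens_liftD]. *)
Definition tens_lift (V : zmodType) (f : M -> N -> V) (t : tensor) : V :=
  \sum_(p <- repr t) f p.1 p.2.

Lemma tens_eq_lift (V : zmodType) (f : M -> N -> V) s t :
  balanced f -> tens_eq s t ->
  \sum_(p <- s) f p.1 p.2 = \sum_(p <- t) f p.1 p.2.
Proof.
case=> fDl fDr fbal; elim=> {s t} //.
- by move=> s t u _ -> _ ->.
- by move=> s s' t t' _ IHs _ IHt; rewrite !big_cat /= IHs IHt.
- by move=> s t; rewrite !big_cat /= addrC.
- move=> y; rewrite big_seq1 big_nil /=.
  by apply: (addrI (f 0 y)); rewrite -fDl !addr0.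
- by move=> x x' y; rewrite !big_cons !big_nil /= !addr0 fDl.
- by move=> x y y'; rewrite !big_cons !big_nil /= !addr0 fDr.
- by move=> x a y; rewrite !big_seq1 fbal.
Qed.

Lemma tens_lift_of (V : zmodType) (f : M -> N -> V) s :
  balanced f -> tens_lift f (tens_of s) = \sum_(p <- s) f p.1 p.2.
Proof. by move=> fb; apply: tens_eq_lift => //; apply: tens_eq_repr. Qed.

Lemma tens_liftE (V : zmodType) (f : M -> N -> V) x y :
  balanced f -> tens_lift f (tens x y) = f x y.
Proof. by move=> fb; rewrite tens_lift_of // big_seq1. Qed.

Lemma tens_liftD (V : zmodType) (f : M -> N -> V) :
  balanced f -> {morph tens_lift f : t u / t + u}.
Proof.
move=> fb; elim/tens_ind=> s; elim/tens_ind=> t.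
by rewrite -[tens_of s + _]/(tadd _ _) taddE !tens_lift_of // big_cat.
Qed.

Lemma tens_morph_eq (V : zmodType) (h k : tensor -> V) :
  {morph h : t u / t + u} -> {morph k : t u / t + u} ->
  (forall x y, h (tens x y) = k (tens x y)) -> h =1 k.
Proof.
move=> hD kD hk t; rewrite (tens_sumE t).
have h0 : h 0 = 0 by apply: (addrI (h 0)); rewrite -hD !addr0.
have k0 : k 0 = 0 by apply: (addrI (k 0)); rewrite -kD !addr0.
by rewrite (big_morph h hD h0) (big_morph k kD k0); apply: eq_bigr => p _.
Qed.

Definition tens_lact (a : A) (t : tensor) : tensor :=
  tens_lift (fun x y => tens (a *: x) y) t.
Definition tens_ract (t : tensor) (a : A) : tensor :=
  tens_lift (fun x y => tens x (ract y a)) t.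

Lemma lact_balanced (a : A) : balanced (fun x y => tens (a *: x) y).
Proof.
case: tens_balanced => tDl tDr tb.
split=> [x x' y|x y y'|x b y]; first by rewrite scalerDr tDl.
- by rewrite tDr.
- by rewrite scaler_ract tb.
Qed.

Lemma ract_balanced (a : A) : balanced (fun x y => tens x (ract y a)).
Proof.
case: tens_balanced => tDl tDr tb.
split=> [x x' y|x y y'|x b y]; first by rewrite tDl.
- by rewrite ractDl tDr.
- by rewrite tb scaler_ract.
Qed.

Lemma tens_lactE a x y : tens_lact a (tens x y) = tens (a *: x) y.
Proof. exact/tens_liftE/lact_balanced. Qed.

Lemma tens_ractE a x y : tens_ract (tens x y) a = tens x (ract y a).
Proof. by rewrite /tens_ract tens_liftE //; exact: ract_balanced. Qed.

Lemma tens_lactD a : {morph tens_lact a : t u / t + u}.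
Proof. exact/tens_liftD/lact_balanced. Qed.

Lemma tens_ractD a : {morph tens_ract^~ a : t u / t + u}.
Proof. exact/tens_liftD/ract_balanced. Qed.

Lemma tens_lactDl t : {morph tens_lact^~ t : a b / a + b}.
Proof.
move=> a b; pose k u : tensor := tens_lact a u + tens_lact b u.
apply: (tens_morph_eq (k := k)) => [|u v|x y]; first exact: tens_lactD.
- by rewrite /k !tens_lactD addrACA.
- by rewrite /k !tens_lactE scalerDl; case: tens_balanced.
Qed.

Lemma tens_lactA a b t : tens_lact a (tens_lact b t) = tens_lact (a * b) t.
Proof.
move: t; apply: tens_morph_eq => [u v|u v|x y].
- by rewrite !tens_lactD.
- by rewrite !tens_lactD.
- by rewrite !tens_lactE scalerA.
Qed.

Lemma tens_lact1 : left_id 1 tens_lact.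
Proof.
apply: tens_morph_eq => [u v|u v|x y] //; first by rewrite tens_lactD.
by rewrite tens_lactE scale1r.
Qed.

HB.instance Definition _ := GRing.Zmodule_isLmodule.Build A tensor
  tens_lactA tens_lact1 tens_lactD tens_lactDl.

Lemma tens_ractDr t a b : tens_ract t (a + b) = tens_ract t a + tens_ract t b.
Proof.
pose k u : tensor := tens_ract u a + tens_ract u b.
move: t; apply: (tens_morph_eq (k := k)) => [u v|u v|x y].
- by rewrite !tens_ractD.
- by rewrite /k !tens_ractD addrACA.
- by rewrite /k !tens_ractE ractDr; case: tens_balanced.
Qed.

Lemma tens_ract1 t : tens_ract t 1 = t.
Proof.
move: t; apply: tens_morph_eq => [u v|u v|x y] //; first by rewrite tens_ractD.
by rewrite tens_ractE ract1.
Qed.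

Lemma tens_ractM t a b : tens_ract t (a * b) = tens_ract (tens_ract t a) b.
Proof.
move: t; apply: tens_morph_eq => [u v|u v|x y].
- by rewrite !tens_ractD.
- by rewrite !tens_ractD.
- by rewrite !tens_ractE ractM.
Qed.

Lemma tens_scaler_ract (a : A) t b :
  a *: tens_ract t b = tens_ract (a *: t) b.
Proof.
move: t; apply: tens_morph_eq => [u v|u v|x y].
- by rewrite tens_ractD scalerDr.
- by rewrite scalerDr tens_ractD.
- by rewrite tens_ractE -![_ *: tens _ _]/(tens_lact _ _) !tens_lactE tens_ractE.
Qed.

Lemma tens_ractZ t (k : C) : tens_ract t k%:A = k%:A *: t.
Proof.
case: tens_balanced => _ _ tb.
move: t; apply: tens_morph_eq => [u v|u v|x y].
- by rewrite tens_ractD.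
- by rewrite scalerDr.
- rewrite tens_ractE -[_ *: tens _ _]/(tens_lact _ _) tens_lactE.
  by rewrite ractA -tb ractA.
Qed.

HB.instance Definition _ := Lmodule_isBimodule.Build C A tensor
  tens_ractD tens_ractDr tens_ract1 tens_ractM tens_scaler_ract tens_ractZ.

End Tensor.

Section TensorDagger.
Context {C : numClosedFieldType} {A : starAlgType C}.
Variable M : daggerBimodType A.
Local Notation T := (tensor M M).

Definition tens_dag (t : T) : T := tens_lift (fun x y => tens (dag y) (dag x)) t.

Lemma dag_balanced : balanced (fun x y : M => tens (dag y) (dag x)).
Proof.
case: (tens_balanced M M) => tDl tDr tb.
split=> [x x' y|x y y'|x a y]; first by rewrite dagD tDr.
- by rewrite dagD tDl.
- by rewrite dag_ract dag_scale tb.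
Qed.

Lemma tens_dagE (x y : M) : tens_dag (tens x y) = tens (dag y) (dag x).
Proof. exact/tens_liftE/dag_balanced. Qed.

Lemma tens_dagD : {morph tens_dag : t u / t + u}.
Proof. exact/tens_liftD/dag_balanced. Qed.

Lemma tens_dagZ (k : C) (t : T) : tens_dag (k%:A *: t) = (k^*)%:A *: tens_dag t.
Proof.
case: (tens_balanced M M) => _ _ tb.
move: t; apply: tens_morph_eq => [u v|u v|x y].
- by rewrite scalerDr tens_dagD.
- by rewrite tens_dagD scalerDr.
- rewrite -[_ *: tens _ _]/(tens_lact _ _) tens_lactE !tens_dagE.
  rewrite -[RHS]/(tens_lact _ _) tens_lactE dagZ -tb.
  by rewrite ractA.
Qed.

Lemma tens_dagK : involutive tens_dag.
Proof.
apply: tens_morph_eq => [u v|u v|x y] //; first by rewrite !tens_dagD.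
by rewrite !tens_dagE !dagK.
Qed.

Lemma tens_dag_bimod (a : A) (t : T) (b : A) :
  tens_dag (ract (a *: t) b) = ract (star b *: tens_dag t) (star a).
Proof.
move: t; apply: tens_morph_eq => [u v|u v|x y].
- by rewrite scalerDr ractDl tens_dagD.
- by rewrite tens_dagD scalerDr ractDl.
- rewrite -![_ *: tens_dag _]/(tens_lact _ _) -[_ *: tens _ _]/(tens_lact _ _).
  rewrite tens_lactE -![ract _ _]/(tens_ract _ _) tens_ractE !tens_dagE.
  by rewrite tens_lactE tens_ractE dag_ract dag_scale.
Qed.

HB.instance Definition _ := Bimodule_isDagger.Build C A T
  tens_dagD tens_dagZ tens_dagK tens_dag_bimod.

End TensorDagger.

HB.mixin Record Lmodule_isLieAlgebra (K : comNzRingType) L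
    of GRing.Lmodule K L := {
  lie : L -> L -> L;
  lie_linearl : forall y (k : K) x x', lie (k *: x + x') y = k *: lie x y + lie x' y;
  lie_linearr : forall x (k : K) y y', lie x (k *: y + y') = k *: lie x y + lie x y';
  liexx : forall x, lie x x = 0;
  lie_jacobi : forall x y z,
    lie x (lie y z) + lie y (lie z x) + lie z (lie x y) = 0 }.

#[short(type="lieAlgType")]
HB.structure Definition LieAlgebra (K : comNzRingType) :=
  {L of GRing.Lmodule K L & Lmodule_isLieAlgebra K L}.

Section Derivations.
Context {C : numClosedFieldType}.
Variable A : starAlgType C.

Definition is_derivation (f : A -> A) : Prop :=
  linear f /\ (forall a b, f (a * b) = f a * b + a * f b).

Definition derivations : {pred A -> A} := fun f => `[< is_derivation f >].

Lemma derivations_submod_closed : submod_closed derivations.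
Proof.
split=> [|k f g /asboolP[fl fM] /asboolP[gl gM]]; apply/asboolP; split.
- by move=> l a b; rewrite scaler0 addr0.
- by move=> a b; rewrite mul0r mulr0 addr0.
- move=> l a b; rewrite -[LHS]/(k *: f _ + g _) fl gl.
  rewrite -[X in _ = _ *: X + _]/(k *: f a + g a).
  rewrite -[X in _ = _ + X]/(k *: f b + g b).
  by rewrite !scalerDr !scalerA [k * l]mulrC addrACA.
- move=> a b; rewrite -[LHS]/(k *: f _ + g _) fM gM.
  rewrite -[X in _ = X * _ + _]/(k *: f a + g a).
  rewrite -[X in _ = _ + _ * X]/(k *: f b + g b).
  by rewrite scalerDr mulrDl mulrDr scalerAl scalerAr addrACA.
Qed.

HB.instance Definition _ :=
  GRing.isSubmodClosed.Build C (A -> A) derivations derivations_submod_closed.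

Record der := Der { der_fun :> A -> A; derP : der_fun \in derivations }.

HB.instance Definition _ := [isSub for der_fun].
HB.instance Definition _ := [Choice of der by <:].
HB.instance Definition _ := [SubChoice_isSubLmodule of der by <:].

Lemma der_linear (f : der) : linear f.
Proof. by case: f => f /= /asboolP[]. Qed.

Lemma derM (f : der) a b : f (a * b) = f a * b + a * f b.
Proof. by case: f => f /= /asboolP[]. Qed.

Lemma der_eq (f g : der) : f =1 g -> f = g.
Proof. by move=> fg; apply/val_inj/funext. Qed.

Lemma der_commP (f g : der) :
  (fun a : A => f (g a) - g (f a)) \in derivations.
Proof.
have fD (h : der) a b : h (a + b) = h a + h b.
  by have := der_linear h 1 a b; rewrite !scale1r.
have swap (V : zmodType) (x y z w x' w' : V) :
    x + y + (z + w) - (x' + z + (y + w')) = x - x' + (w - w').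
  rewrite [z + w]addrC [y + w']addrC (addrACA x) (addrACA x') [z + y]addrC.
  by rewrite [x' + w' + _]addrC addrKA opprD addrACA.
apply/asboolP; split=> [k a b|a b].
  by rewrite !der_linear scalerBr opprD addrACA.
by rewrite !derM !fD !derM mulrBl mulrBr swap.
Qed.

Definition der_comm (f g : der) : der := Der (der_commP f g).

Lemma der_addE (f g : der) a : (f + g) a = f a + g a.
Proof. by []. Qed.

Lemma der_scaleE (k : C) (f : der) a : (k *: f) a = k *: f a.
Proof. by []. Qed.

Lemma der_commE (f g : der) a : der_comm f g a = f (g a) - g (f a).
Proof. by []. Qed.

Lemma der_comm_linearl (g : der) (k : C) (f f' : der) :
  der_comm (k *: f + f') g = k *: der_comm f g + der_comm f' g.
Proof.
apply: der_eq => a; rewrite !(der_addE, der_scaleE, der_commE).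
by rewrite der_linear scalerBr opprD addrACA.
Qed.

Lemma der_comm_linearr (f : der) (k : C) (g g' : der) :
  der_comm f (k *: g + g') = k *: der_comm f g + der_comm f g'.
Proof.
apply: der_eq => a; rewrite !(der_addE, der_scaleE, der_commE).
by rewrite der_linear scalerBr opprD addrACA.
Qed.

Lemma der_comm_alt (f : der) : der_comm f f = 0.
Proof. by apply: der_eq => a; rewrite der_commE subrr. Qed.

Lemma der_comm_jacobi (f g h : der) :
  der_comm f (der_comm g h) + der_comm g (der_comm h f)
    + der_comm h (der_comm f g) = 0.
Proof.
have dB (u : der) a b : u (a - b) = u a - u b.
  by have := der_linear u (-1) b a; rewrite !scaleN1r ![- _ + _]addrC.
have cyc (V : zmodType) (p q r s t u : V) :
    p - q - (r - s) + (r - t - (u - q)) + (u - s - (p - t)) = 0.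
  rewrite !opprB [p - q + _]addrA -[r - t + _]addrA subrKA.
  rewrite [p - q + s]addrC [s + (p - q)]addrA [- t + _]addrC.
  rewrite -[q - u - t]addrA subrKA.
  by rewrite [u - s + _]addrACA -!opprD subrKA subrr.
by apply: der_eq => a; rewrite !(der_addE, der_commE) !dB cyc.
Qed.

HB.instance Definition _ := Lmodule_isLieAlgebra.Build C der
  der_comm_linearl der_comm_linearr der_comm_alt der_comm_jacobi.

Definition hermitian_der : set der :=
  [set f | forall a, star (f (star a)) = f a].

End Derivations.

Section LieSubalgebras.
Context {C : numClosedFieldType} {L : lieAlgType C}.

Definition complex_lie_subalgebra (S : set L) : Prop :=
  [/\ S 0, (forall x y, S x -> S y -> S (x + y)),
      (forall (k : C) x, S x -> S (k *: x))
    & (forall x y, S x -> S y -> S (lie x y))].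

(* For C = R[i], the elements of [Num.real] are exactly those of the copy of R. *)
Definition real_lie_subalgebra (S : set L) : Prop :=
  [/\ S 0, (forall x y, S x -> S y -> S (x + y)),
      (forall k : C, k \is Num.real -> forall x, S x -> S (k *: x))
    & (forall x y, S x -> S y -> S (lie x y))].

End LieSubalgebras.

Arguments hermitian_der {C} A.

Lemma hermitian_der_real_lie (C : numClosedFieldType) (A : starAlgType C) :
  real_lie_subalgebra (hermitian_der A).
Proof.
have s0 : star (0 : A) = 0 by apply: (addrI (star 0)); rewrite -starD !addr0.
have sB (a b : A) : star (a - b) = star a - star b.
  by apply: (addIr (star b)); rewrite -starD !subrK.
have sf (f : der A) a : hermitian_der A f -> f (star a) = star (f a).
  by move=> /(_ a) <-; rewrite starK.
split=> [a|f g hf hg a|k kR f hf a|f g hf hg a].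
- exact: s0.
- by rewrite der_addE starD hf hg.
- by rewrite der_scaleE starZ (CrealP kR) hf.
- by rewrite der_commE sB !sf // !starK.
Qed.

Section Calculus.
Context {C : numClosedFieldType} {A : starAlgType C}.

Record hermitian_fods (Omega : daggerBimodType A) := HermitianFODS {
  fods_d : A -> Omega;
  fods_form : Omega -> Omega -> A;
  fods_d_linear : forall (k : C) a b,
    fods_d (k *: a + b) = k%:A *: fods_d a + fods_d b;
  fods_d_leibniz : forall a b,
    fods_d (a * b) = ract (fods_d a) b + a *: fods_d b;
  fods_d_star : forall a, fods_d (star a) = - dag (fods_d a);
  fods_gen : forall w, exists s : seq (A * A),
    w = \sum_(p <- s) p.1 *: fods_d p.2;
  fods_fgp : fg_projective Omega;
  fods_formDl : forall w w' h,
    fods_form (w + w') h = fods_form w h + fods_form w' h;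
  fods_formDr : forall w h h',
    fods_form w (h + h') = fods_form w h + fods_form w h';
  fods_form_ract : forall w h a, fods_form w (ract h a) = fods_form w h * a;
  fods_form_star : forall w h, star (fods_form w h) = fods_form h w;
  fods_form_adj : forall a w h,
    fods_form (a *: w) h = fods_form w (star a *: h);
  (* w |-> fods_form (dag w) is an isomorphism of left A-modules onto the
     right A-linear maps f : Omega -> A, on which A acts by
     (a f)(h) = a * f h. *)
  fods_dual_right_linear : forall w, right_linear (fods_form (dag w));
  fods_dual_linear : forall a w w' h,
    fods_form (dag (a *: w + w')) h
      = a * fods_form (dag w) h + fods_form (dag w') h;
  fods_dual_inj : injective (fun w => fods_form (dag w));
  fods_dual_surj : forall f : Omega -> A, right_linear f ->
    exists w, fods_form (dag w) = f }.

Section Notions.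
Variables (Omega : daggerBimodType A) (X : hermitian_fods Omega).
Local Notation T2 := (tensor Omega Omega).
Local Notation d := (fods_d X).

Definition is_sigma_can (sigma : T2 -> T2) : Prop :=
  [/\ bimodule_map sigma,
      (exists sigma' : T2 -> T2,
        [/\ cancel sigma sigma', cancel sigma' sigma
          & forall t, sigma' (dag t) = dag (sigma t)])
    & (forall w h : Omega, centre w \/ centre h ->
        sigma (tens w h) = tens h w)].

Definition Psi (sigma : T2 -> T2) (t : T2) : T2 :=
  (2^-1 : C)%:A *: (t + sigma t).

Definition metric_g (t : T2) : A :=
  tens_lift (fun w h => - fods_form X (dag w) h) t.

Lemma metric_g_balanced : balanced (fun w h => - fods_form X (dag w) h).
Proof.
split=> [w w' h|w h h'|w a h]; first by rewrite dagD fods_formDl opprD.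
- by rewrite fods_formDr opprD.
- by rewrite dag_ract fods_form_adj starK.
Qed.

Lemma metric_gE w h : metric_g (tens w h) = - fods_form X (dag w) h.
Proof. exact/tens_liftE/metric_g_balanced. Qed.

Definition JT2 : set T2 := [set t | exists s : seq (A * A),
  \sum_(p <- s) p.1 *: d p.2 = 0 /\ t = \sum_(p <- s) tens (d p.1) (d p.2)].

Definition D_C : set (der A) := [set f | forall s : seq (A * A),
  \sum_(p <- s) p.1 *: d p.2 = 0 -> \sum_(p <- s) p.1 * f p.2 = 0].

Definition D_herm : set (der A) := D_C `&` hermitian_der A.

End Notions.

Record centred_hermitian_calculus (Omega : daggerBimodType A) :=
  CentredHermitianCalculus {
    chc_fods :> hermitian_fods Omega;
    chc_centred : centred Omega;
    chc_sigma : tensor Omega Omega -> tensor Omega Omega;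
    chc_sigma_can : is_sigma_can chc_sigma;
    chc_g_sigma : forall t,
      metric_g chc_fods (chc_sigma t) = metric_g chc_fods t;
    chc_JT2 : JT2 chc_fods `<=` range (Psi chc_sigma) }.

End Calculus.

(* Main.v *)
Require Import Defs.
From mathcomp Require Import all_boot all_order all_algebra complex.
From mathcomp Require Import boolp classical_sets reals.

Set Implicit Arguments.
Unset Strict Implicit.
Unset Printing Implicit Defensive.

Import GRing.Theory.

Local Open Scope classical_set_scope.
Local Open Scope ring_scope.

(** A derivation [f] lies in [D_C] exactly when [a d b |-> a f b] is a well
    defined map [phi_f] from [Omega] to [A], and [phi_f] is then a bimodule map;
    in particular it sends central forms to central elements of [A].  Applying
    [f] to [sum a_i g b_i = 0] and [g] to [sum a_i f b_i = 0] shows that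
    [sum a_i [f, g] b_i] is [phi_g (x) phi_f - phi_f (x) phi_g] evaluated at
    [sum d a_i (x) d b_i].  As [Omega] is centred, composing [phi_f (x) phi_g]
    with [sigma] exchanges [f] and [g], so this antisymmetric combination
    vanishes on the image of [Psi], which contains [JT2]. *)

Section DerivationContraction.
Context {C : numClosedFieldType} {A : starAlgType C}.

Section Additive.
Context {V W : zmodType} (h : V -> W).
Hypothesis hD : {morph h : x y / x + y}.

Lemma additive0 : h 0 = 0.
Proof. by apply: (addrI (h 0)); rewrite -hD !addr0. Qed.

Lemma additive_sum (I : Type) (s : seq I) (F : I -> V) :
  h (\sum_(i <- s) F i) = \sum_(i <- s) h (F i).
Proof. exact: (big_morph h hD additive0). Qed.

End Additive.

Lemma derD (f : der A) : {morph f : a b / a + b}.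
Proof. by move=> a b; have := der_linear f 1 a b; rewrite !scale1r. Qed.

Variables (Omega : daggerBimodType A) (X : hermitian_fods Omega).
Local Notation d := (fods_d X).

(** This is [phi_f], computed on a presentation of [w] picked by choice; the value is independent of
    that choice once [f] lies in [D_C]. *)
Definition contraction (f : der A) (w : Omega) : A :=
  \sum_(p <- projT1 (cid (fods_gen X w))) p.1 * f p.2.

Section Contraction.
Variables (f : der A) (fD : D_C X f).

(** The chosen presentation followed by the negated [s] presents the zero form, so membership in
    [D_C] applies to it. *)
Lemma contraction_sum (s : seq (A * A)) :
  contraction f (\sum_(p <- s) p.1 *: d p.2) = \sum_(p <- s) p.1 * f p.2.
Proof.
rewrite /contraction; case: cid => t /= st; apply/eqP; rewrite -subr_eq0.
apply/eqP; have := fD (s := t ++ [seq (- p.1, p.2) | p <- s]).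
rewrite !big_cat !big_map /= -st.
have -> : \sum_(p <- s) - p.1 *: d p.2 = - \sum_(p <- s) p.1 *: d p.2.
  by rewrite -sumrN; apply: eq_bigr => p _; rewrite scaleNr.
have -> : \sum_(p <- s) - p.1 * f p.2 = - \sum_(p <- s) p.1 * f p.2.
  by rewrite -sumrN; apply: eq_bigr => p _; rewrite mulNr.
by rewrite subrr; apply.
Qed.

Lemma contractionE a b : contraction f (a *: d b) = a * f b.
Proof. by have := contraction_sum [:: (a, b)]; rewrite !big_seq1. Qed.

Lemma contraction_d b : contraction f (d b) = f b.
Proof. by rewrite -[d b]scale1r contractionE mul1r. Qed.

Lemma contractionD : {morph contraction f : x y / x + y}.
Proof.
move=> x y; have [s ->] := fods_gen X x; have [t ->] := fods_gen X y.
by rewrite -big_cat !contraction_sum big_cat.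
Qed.

Lemma contractionZ a w : contraction f (a *: w) = a * contraction f w.
Proof.
have [s ->] := fods_gen X w.
rewrite scaler_sumr !(additive_sum contractionD) mulr_sumr.
by apply: eq_bigr => p _; rewrite scalerA !contractionE mulrA.
Qed.

Lemma contraction_ract w a : contraction f (ract w a) = contraction f w * a.
Proof.
have [s ->] := fods_gen X w.
rewrite (additive_sum (ractDl a)) !(additive_sum contractionD) mulr_suml.
apply: eq_bigr => p _; rewrite -scaler_ract contractionZ contractionE.
(* The Leibniz rule for [d] rewrites the right action through left multiples of differentials; the
   Leibniz rule for [f] then undoes it in [A]. *)
have -> : ract (d p.2) a = d (p.2 * a) + (- p.2) *: d a.
  by rewrite fods_d_leibniz scaleNr addrK.
by rewrite contractionD contraction_d contractionE derM mulNr addrK mulrA.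
Qed.

Lemma contraction_centre z a :
  centre z -> a * contraction f z = contraction f z * a.
Proof. by move=> zC; rewrite -contractionZ zC contraction_ract. Qed.

End Contraction.

Definition contraction2 (f g : der A) : tensor Omega Omega -> A :=
  tens_lift (fun w h => contraction f w * contraction g h).

Section Contraction2.
Variables (f g : der A) (fD : D_C X f) (gD : D_C X g).

Lemma contraction2_balanced :
  balanced (fun w h : Omega => contraction f w * contraction g h).
Proof.
split=> [x x' y|x y y'|x a y].
- by rewrite contractionD // mulrDl.
- by rewrite contractionD // mulrDr.
- by rewrite contraction_ract // contractionZ // mulrA.
Qed.

Lemma contraction2E x y :
  contraction2 f g (tens x y) = contraction f x * contraction g y.
Proof. exact/tens_liftE/contraction2_balanced. Qed.

Lemma contraction2D : {morph contraction2 f g : t u / t + u}.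
Proof. exact/tens_liftD/contraction2_balanced. Qed.

Lemma contraction2Z a t : contraction2 f g (a *: t) = a * contraction2 f g t.
Proof.
rewrite (tens_sumE t) scaler_sumr !(additive_sum contraction2D) mulr_sumr.
apply: eq_bigr => p _.
rewrite -[_ *: tens _ _]/(tens_lact _ _) tens_lactE !contraction2E.
by rewrite contractionZ // mulrA.
Qed.

Lemma contraction2_ract t a :
  contraction2 f g (ract t a) = contraction2 f g t * a.
Proof.
rewrite (tens_sumE t) (additive_sum (ractDl a)).
rewrite !(additive_sum contraction2D) mulr_suml.
apply: eq_bigr => p _.
rewrite -[ract (tens _ _) _]/(tens_ract _ _) tens_ractE !contraction2E.
by rewrite contraction_ract // mulrA.
Qed.

End Contraction2.

(** For central [y], [sigma] flips [x (x) y], and [phi_f y] commutes with [phi_g x]. The [y]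
    satisfying the identity form a sub-bimodule, which is all of [Omega] by centredness. *)
Lemma contraction2_sigma (sigma : tensor Omega Omega -> tensor Omega Omega)
    (f g : der A) :
  centred Omega -> is_sigma_can sigma -> D_C X f -> D_C X g ->
  forall t, contraction2 f g (sigma t) = contraction2 g f t.
Proof.
move=> Omega_centred [[sigmaD _ sigma_ract] _ sigma_flip] fD gD.
have [tDl tDr tb] := tens_balanced Omega Omega.
have cD := contraction2D fD gD; have cD' := contraction2D gD fD.
apply: tens_morph_eq => [t u|//|x y]; first by rewrite sigmaD cD.
(* Quantifying over all [x] gives stability under the left action: [x (x) a y] is [x a (x) y], an
   instance with another [x]. *)
pose P : set Omega := [set y | forall x,
  contraction2 f g (sigma (tens x y)) = contraction2 g f (tens x y)].
suff : P y by apply.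
have : [set: Omega] y by [].
rewrite -Omega_centred; move: y; apply: smallest_sub => [|z zC w] /=; last first.
  rewrite sigma_flip; last by right.
  by rewrite !contraction2E // (contraction_centre fD).
split=> [w|y y' Py Py' w|a y Py w|y a Py w].
- have tens0r : tens w (0 : Omega) = 0 by exact: (additive0 (tDr w)).
  by rewrite tens0r (additive0 sigmaD) (additive0 cD) (additive0 cD').
- by rewrite tDr sigmaD cD cD' Py Py'.
- by rewrite -tb Py.
- rewrite -[tens w _]tens_ractE -![tens_ract _ _]/(ract _ _) sigma_ract.
  by rewrite !contraction2_ract // Py.
Qed.

(** Precomposing [phi_f (x) phi_g] with [1 + sigma] yields [phi_f (x) phi_g + phi_g (x) phi_f],
    which is symmetric in [f] and [g]. *)
Lemma contraction2_Psi (sigma : tensor Omega Omega -> tensor Omega Omega)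
    (f g : der A) :
  centred Omega -> is_sigma_can sigma -> D_C X f -> D_C X g ->
  forall t, contraction2 f g (Psi sigma t) = contraction2 g f (Psi sigma t).
Proof.
move=> cO sc fD gD t; rewrite /Psi !contraction2Z // !contraction2D //.
by rewrite !(contraction2_sigma cO sc) // addrC.
Qed.

Lemma contraction2_JT2 (s : seq (A * A)) (f g : der A) :
  D_C X f -> D_C X g ->
  contraction2 f g (\sum_(p <- s) tens (d p.1) (d p.2))
    = \sum_(p <- s) f p.1 * g p.2.
Proof.
move=> fD gD; rewrite (additive_sum (contraction2D fD gD)).
by apply: eq_bigr => p _; rewrite contraction2E // !contraction_d.
Qed.

(** Expand [f] of the vanishing sum of the [a_i g b_i] by the Leibniz rule. *)
Lemma der_comp_D_C (f g : der A) (s : seq (A * A)) :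
  D_C X g -> \sum_(p <- s) p.1 *: d p.2 = 0 ->
  \sum_(p <- s) p.1 * f (g p.2) = - \sum_(p <- s) f p.1 * g p.2.
Proof.
move=> gD s0; have := congr1 f (gD s s0).
rewrite (additive0 (derD f)) (additive_sum (derD f)) => fg0.
apply/eqP; rewrite -addr_eq0 addrC -big_split /= -[X in _ == X]fg0; apply/eqP.
by apply: eq_bigr => p _; rewrite derM.
Qed.

End DerivationContraction.

Lemma D_C_lie_subalgebra (C : numClosedFieldType) (A : starAlgType C)
    (Omega : daggerBimodType A) (X : centred_hermitian_calculus Omega) :
  complex_lie_subalgebra (D_C X).
Proof.
split=> [s _|f g fD gD s s0|k f fD s s0|f g fD gD s s0].
- by apply: big1 => p _; rewrite mulr0.
- under eq_bigr do rewrite der_addE mulrDr.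
  by rewrite big_split /= fD // gD // addr0.
- under eq_bigr do rewrite der_scaleE -scalerAr.
  by rewrite -scaler_sumr fD // scaler0.
- under eq_bigr do rewrite der_commE mulrBr.
  rewrite sumrB (der_comp_D_C f gD) // (der_comp_D_C g fD) //.
  rewrite -(contraction2_JT2 s fD gD) -(contraction2_JT2 s gD fD).
  (* By [s0] the tensor lies in [JT2], hence equals [Psi t] for some [t], where the two contractions
     agree and cancel. *)
  have /(chc_JT2 (c := X))[t _ <-] :
      JT2 X (\sum_(p <- s) tens (fods_d X p.1) (fods_d X p.2)) by exists s.
  rewrite (contraction2_Psi (chc_centred X) (chc_sigma_can X) fD gD).
  by rewrite subrr.
Qed.

Theorem theorem3p21 (R : realType) (A : starAlgType R[i])
    (Omega : daggerBimodType A) (X : centred_hermitian_calculus Omega) :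
  complex_lie_subalgebra (D_C X)
  /\ D_herm X `<=` hermitian_der A /\ real_lie_subalgebra (D_herm X).
Proof.
have [D0 DD DZ Dlie] := D_C_lie_subalgebra X.
have [h0 hD hZ hlie] := hermitian_der_real_lie A.
split; first exact: D_C_lie_subalgebra.
(* Each closure property of the intersection comes from its two members; only the Hermitian one
   restricts scalars to real [k]. *)
split=> [f []//|]; split=> [|f g [? ?] [? ?]|k kR f [? ?]|f g [? ?] [? ?]].
- by split.
- by split; [exact: DD|exact: hD].
- by split; [exact: DZ|exact: hZ].
- by split; [exact: Dlie|exact: hlie].
Qed.
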